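(* The triples of the form $(a,b,c)=(2,p,p+2)$ with $p$ and $p+2$ both prime satisfy $$q_{\mathrm{DGM}}(2,p,p+2)\in\mathcal{O}\left(\frac{(\ln c)^{1/3}}{3(\ln 2)^{1/3}}\right)$$ as $c=p+2\to\infty$; and if the twin prime conjecture holds (there are infinitely many primes $p$ with $p+2$ prime), then $\limsup_{c\to\infty}s_c=\infty$.
   Context: An abc-triple is a triple $(a,b,c)$ of positive integers with $a+b=c$ and $\gcd(a,b)=\gcd(b,c)=\gcd(a,c)=1$. For an abc-triple, $\omega=\omega(abc)$ is the number of distinct primes $p_1,\dots,p_\omega$ dividing $abc$. For a finite set $S=\{x_1,\dots,x_k\}$ of positive reals, $\mathrm{DGM}(S)=\exp\big(\exp\big(\tfrac1k\sum_{i=1}^k\ln\ln x_i\big)\big)$. The DGM quality is $q_{\mathrm{DGM}}(a,b,c)=\dfrac{\ln c}{\ln(\mathrm{DGM}(\{p^\omega: p\mid abc,\ p\text{ prime}\}))}$, equivalently $q_{\mathrm{DGM}}(a,b,c)=\dfrac{\ln c}{\omega\,\big(\prod_{i=1}^{\omega}\ln p_i\big)^{1/\omega}}$. For an integer $c\ge 2$, $s_c=\max\{q_{\mathrm{DGM}}(a,b,c):(a,b,c)\text{ is an abc-triple}\}$, the maximum being over $a,b$ with $c$ fixed. *)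

(* Defs.v *)
From HB Require Import structures.
From mathcomp Require Import all_boot all_order all_algebra finmap.
From mathcomp Require Import all_classical all_reals all_analysis.
Set Implicit Arguments.
Unset Strict Implicit.
Unset Printing Implicit Defensive.
Import Order.TTheory GRing.Theory Num.Theory.
Import numFieldNormedType.Exports.
Local Open Scope classical_set_scope.
Local Open Scope ring_scope.

Definition abc_triple (a b c : nat) : bool :=
  [&& (0 < a)%N, (0 < b)%N, (0 < c)%N, (a + b == c)%N,
      coprime a b, coprime b c & coprime a c].

Definition omega (n : nat) : nat := size (primes n).

(* Both logarithms are junk-valued (0) at nonpositive reals, so this is
   meaningful for nonempty sets of reals greater than 1. *)
Definition DGM (R : realType) (S : {fset R}) : R :=
  expR (expR ((#|` S|%:R)^-1 * \sum_(x <- S) ln (ln x))).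

Definition q_DGM (R : realType) (a b c : nat) : R :=
  ln c%:R /
  ln (DGM [fset (p%:R : R) ^+ omega (a * b * c) | p in primes (a * b * c)]%fset).
Arguments q_DGM R a b c : clear implicits.

Definition dgm_qualities (R : realType) (c : nat) : set R :=
  [set q | exists a b, abc_triple a b c /\ q = q_DGM R a b c].
Arguments dgm_qualities R c : clear implicits.

Definition s_max (R : realType) (c : nat) : R := sup (dgm_qualities R c).
Arguments s_max R c : clear implicits.

(* For c >= 2 the supremum defining [s_max] is a maximum; the values at
   c = 0 and c = 1 are irrelevant. *)
Lemma s_max_maximum (R : realType) (c : nat) : (2 <= c)%N ->
  dgm_qualities R c (s_max R c) /\
  (forall q, dgm_qualities R c q -> q <= s_max R c).
Proof.
move=> c2; pose P (t : 'I_c.+1 * 'I_c.+1) := abc_triple t.1 t.2 c.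
pose F (t : 'I_c.+1 * 'I_c.+1) := q_DGM R t.1 t.2 c.
have c0 : (0 < c)%N by apply: leq_trans c2.
have P0 : P (inord 1, inord c.-1).
  rewrite /P /= !inordK ?ltnS ?leq_pred //.
  rewrite /abc_triple c0 /= add1n prednK // eqxx coprime1n /=.
  by rewrite coprime1n coprimePn // !andbT -ltnS prednK.
have ub q : dgm_qualities R c q -> exists2 t, P t & q = F t.
  move=> [a [b [abc ->]]]; have /and4P[_ _ _ /andP[/eqP abE _]] := abc.
  have ac : (a < c.+1)%N by rewrite ltnS -abE leq_addr.
  have bc : (b < c.+1)%N by rewrite ltnS -abE leq_addl.
  by exists (Ordinal ac, Ordinal bc).
case: (@arg_maxP _ R _ _ P F P0) => t Pt tmax.
have Qt : dgm_qualities R c (F t) by exists t.1, t.2.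
have Fub q : dgm_qualities R c q -> q <= F t.
  by move=> /ub[u Pu ->]; exact: tmax.
suff -> : s_max R c = F t by [].
apply/eqP; rewrite eq_le; apply/andP; split.
  by apply: ge_sup => //; exists (F t).
by apply: ub_le_sup => //; exists (F t).
Qed.

Definition twin_prime (p : nat) : bool := prime p && prime p.+2.

Definition twin_prime_conjecture : Prop :=
  infinite_set [set p | twin_prime p].

(* Main.v *)
(* For twin primes the primes dividing abc are 2, p and c = p + 2, so with
   L = ln c the quality is L / (3 (ln 2 * ln p * L)^(1/3)), that is
   (L / ln p)^(1/3) times L^(1/3) / (3 (ln 2)^(1/3)).  Since p <= c <= p^2, the
   first factor lies in [1, 2]; the upper bound gives the O-estimate, the lower
   bound the divergence of the limsup along twin primes. *)
Require Import Defs.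
From mathcomp Require Import all_boot all_order all_algebra finmap.
From mathcomp Require Import all_classical all_reals all_analysis.
From mathcomp Require Import zify ring lra.
Import Order.TTheory GRing.Theory Num.Theory.
Import numFieldNormedType.Exports.
Local Open Scope classical_set_scope.
Local Open Scope ring_scope.

(** The case [p = 2] fails since 4 is composite; hence 2, [p], [p.+2] are distinct and
    increasing. *)
Lemma twin_prime_gt2 p : twin_prime p -> (2 < p)%N.
Proof.
case/andP => pp pp2; rewrite ltn_neqAle prime_gt1 // andbT.
by apply: contraL pp2 => /eqP <-.
Qed.

Lemma primes_twin p : twin_prime p -> primes (2 * p * p.+2) = [:: 2; p; p.+2].
Proof.
move=> tp; have p2 := twin_prime_gt2 _ tp; case/andP: tp => pp pp2.
(* A strictly increasing list is determined by its members. *)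
apply: (irr_sorted_eq ltn_trans ltnn); [exact: sorted_primes|by rewrite /= p2 ltnW|].
move=> q; rewrite !primesM ?muln_gt0 ?prime_gt0 // !primes_prime //.
by rewrite !inE orbA.
Qed.

Lemma abc_triple_twin p : twin_prime p -> abc_triple 2 p p.+2.
Proof.
move=> tp; have p2 := twin_prime_gt2 _ tp; case/andP: tp => pp pp2.
rewrite /abc_triple (prime_gt0 pp) add2n eqxx /=.
have codd q : prime q -> (2 < q)%N -> coprime 2 q.
  by move=> qp q2; rewrite prime_coprime // dvdn_prime2 // ltn_eqF.
have p4 : (2 < p.+2)%N by exact: (leqW (leqW p2)).
apply/and3P; split; [exact: codd| |exact: codd].
by rewrite prime_coprime // dvdn_prime2 // ltn_eqF.
Qed.

Lemma q_DGM_twin (R : realType) p : twin_prime p ->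
  q_DGM R 2 p p.+2 =
  ln p.+2%:R / (3 * expR (3^-1 * (ln (ln 2) + ln (ln p%:R) + ln (ln p.+2%:R)))).
Proof.
move=> tp; have p2 := twin_prime_gt2 _ tp.
rewrite /q_DGM /omega primes_twin //=; congr (_ / _).
rewrite /DGM expRK.
set a : R := 2%:R ^+ 3; set b : R := p%:R ^+ 3; set c : R := p.+2%:R ^+ 3.
have -> : [fset (q%:R : R) ^+ 3 | q in [:: 2; p; p.+2]]%fset = [fset a; b; c]%fset.
  apply/fsetP => x; rewrite !inE -!orbA; apply/imfsetP/or3P => /=.
  - move=> [q]; rewrite !inE => /or3P[] /eqP -> ->; rewrite eqxx.
    + by constructor 1.
    + by constructor 2.
    + by constructor 3.
  - by case=> /eqP ->; [exists 2|exists p|exists p.+2]; rewrite ?inE ?eqxx ?orbT.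
(* Distinctness of the three cubes makes the cardinality in the mean equal to 3. *)
have ab : a < b by rewrite ltrXn2r ?ltr_nat // -lt0n ltnW // ltnW.
have bc : b < c by rewrite ltrXn2r ?ltr_nat // -lt0n.
have uabc : uniq [:: a; b; c].
  by rewrite /= !inE !negb_or !lt_eqF // (lt_trans ab bc).
have pabc : perm_eq [fset a; b; c]%fset [:: a; b; c].
  by apply: uniq_perm => // x; rewrite !inE orbA.
rewrite (perm_size pabc) (perm_big _ pabc) /= !big_cons big_nil addr0.
have lnln (x : nat) : (1 < x)%N -> ln (ln ((x%:R : R) ^+ 3)) = ln 3 + ln (ln x%:R).
  move=> x1; rewrite lnXn; last by rewrite ltr0n ltnW.
  by rewrite -[ln _ *+ _]mulr_natl lnM ?posrE // ln_gt0 // ltr1n.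
rewrite !lnln //; last exact: ltnW.
(* The three copies of [ln 3], coming from the cubes, average to [ln 3], which gives the factor
   3. *)
rewrite -[X in _ = X * _]lnK ?posrE // -expRD; congr expR.
by field.
Qed.

Lemma powR_lnln (R : realType) (n : nat) : (1 < n)%N ->
  ln (n%:R : R) `^ (3%:R^-1) = expR (3^-1 * ln (ln n%:R)).
Proof. by move=> n1; rewrite /powR gt_eqF // ln_gt0 // ltr1n. Qed.

(** The comparison function of the O-estimate, at [c = p.+2]. *)
Definition twin_rate (R : realType) (p : nat) : R :=
  ln p.+2%:R `^ (3%:R^-1) / (3%:R * ln 2%:R `^ (3%:R^-1)).

Lemma twin_rate_ge0 (R : realType) p : 0 <= twin_rate R p.
Proof. by rewrite divr_ge0 ?mulr_ge0 ?powR_ge0. Qed.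

Lemma q_DGM_twin_ratio (R : realType) p : twin_prime p ->
  q_DGM R 2 p p.+2 =
  expR (3^-1 * (ln (ln p.+2%:R) - ln (ln p%:R))) * twin_rate R p.
Proof.
move=> tp; have p2 := twin_prime_gt2 _ tp.
rewrite q_DGM_twin // /twin_rate !powR_lnln //.
(* With the numerator written as [expR (ln (ln p.+2%:R))], only exponents remain to be compared. *)
rewrite -[X in X / _]lnK ?posrE ?ln_gt0 ?ltr1n //.
rewrite !invfM -!expRN [LHS]mulrCA !(mulrCA _ 3%:R^-1); congr (_ * _).
by rewrite -!expRD; congr expR; field.
Qed.

Lemma ln_le_ln_square (R : realType) (p : nat) : (2 <= p)%N ->
  ln (p.+2%:R : R) <= 2 * ln p%:R.
Proof.
move=> p2; have p0 : (0 < p)%N by apply: leq_trans p2.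
rewrite mulr_natl -lnXn ?ltr0n // -natrX ler_ln ?posrE ?ltr0n ?expn_gt0 ?p0 //.
by rewrite ler_nat; nia.
Qed.

Lemma q_DGM_twin_bounds (R : realType) p : twin_prime p ->
  twin_rate R p <= q_DGM R 2 p p.+2 <= 2 * twin_rate R p.
Proof.
move=> tp; have p2 := twin_prime_gt2 _ tp.
have p1 : (1 < p)%N by apply: ltnW.
have lnp : 0 < ln (p%:R : R) by rewrite ln_gt0 // ltr1n.
have lnc : 0 < ln (p.+2%:R : R) by rewrite ln_gt0 // ltr1n.
have g0 := twin_rate_ge0 R p.
have lo : ln (ln p%:R) <= ln (ln p.+2%:R) :> R.
  rewrite ler_ln ?posrE // ler_ln ?posrE ?ltr0n ?(ltnW p1) // ler_nat.
  by rewrite !leqW.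
have hi : ln (ln p.+2%:R) <= ln 2 + ln (ln p%:R) :> R.
  by rewrite -lnM ?posrE // ler_ln ?posrE ?mulr_gt0 // ln_le_ln_square.
have ln2 : 0 <= ln 2 :> R by rewrite ln_ge0 // ler1n.
rewrite q_DGM_twin_ratio //; apply/andP; split.
  rewrite ler_peMl // (le_trans _ (expR_ge1Dx _)) // lerDl mulr_ge0 ?subr_ge0 //.
(* By [hi] the exponent is at most a third of [ln 2], so the constant 2 is generous. *)
apply: ler_wpM2r => //; rewrite -[leRHS]lnK ?posrE // ler_expR.
by lra.
Qed.

(** The threshold makes [t = (ln (ln c) - ln (ln 2)) / 3] at least [3 * M]; then [twin_rate] is
    [expR t / 3], at least [(1 + 3 * M) / 3]. *)
Lemma q_DGM_twin_unbounded (R : realType) (M : R) (p : nat) : twin_prime p ->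
  expR (expR (9 * M + ln (ln 2))) <= p%:R -> M <= q_DGM R 2 p p.+2.
Proof.
move=> tp hp; have /andP[+ _] := q_DGM_twin_bounds R p tp; apply: le_trans.
have p1 : (1 < p)%N by apply/ltnW/twin_prime_gt2.
have lnc : 0 < ln (p.+2%:R : R) by rewrite ln_gt0 // ltr1n.
rewrite /twin_rate !powR_lnln // invfM -expRN mulrCA -expRD.
have hc : 9 * M + ln (ln 2) <= ln (ln p.+2%:R) :> R.
  rewrite -ler_expR lnK ?posrE // -ler_expR lnK ?posrE ?ltr0n //.
  by apply: (le_trans hp); rewrite ler_nat !leqW.
rewrite mulrC ler_pdivlMr // (le_trans _ (expR_ge1Dx _)) //.
by lra.
Qed.

Lemma infinite_nat_ge (A : set nat) (N : nat) : infinite_set A ->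
  exists2 n, A n & (N <= n)%N.
Proof.
move=> Ainf; apply: contrapT => nA; apply: Ainf.
apply: (sub_finite_set _ (finite_II N)) => n An /=.
by rewrite ltnNge; apply/negP => Nn; apply: nA; exists n.
Qed.

(** Every tail has supremum [+oo], so the sequence of tail suprema is constant. *)
Lemma limn_esup_unbounded (R : realType) (u : nat -> R) :
  (forall M N, exists2 n, (N <= n)%N & M <= u n) ->
  limn_esup (fun n => (u n)%:E) = +oo%E.
Proof.
move=> uub; rewrite limn_esup_lim.
suff -> : esups (fun n => (u n)%:E) = fun=> +oo%E by exact: lim_cst.
apply/funext => N; apply: eq_infty => M; have [n Nn Mn] := uub M N.
apply: (@le_trans _ _ (u n)%:E); first by rewrite lee_fin.
by apply: ereal_sup_ubound; exists n.
Qed.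

Theorem theorem3p10 (R : realType) :
  (fun p : nat => q_DGM R 2 p p.+2) =O_ (within [set p | twin_prime p] \oo)
    (fun p : nat => ln p.+2%:R `^ (3%:R^-1) / (3%:R * ln 2%:R `^ (3%:R^-1)))
  /\
  (twin_prime_conjecture -> limn_esup (fun c : nat => (s_max R c)%:E) = +oo%E).
Proof.
split.
  (* The two-sided bound holds at every twin prime, so the constant 2 works without taking [p]
     large. *)
  apply/eqO_exP; exists 2 => //; rewrite near_withinE; near=> p => /= tp.
  have g0 := twin_rate_ge0 R p.
  have /andP[lo hi] := q_DGM_twin_bounds R p tp.
  by rewrite !ger0_norm // (le_trans g0).
move=> tpc; apply: limn_esup_unbounded => M N.
(* [K] puts [c = p.+2] in the tail from [N] and [p] above the real threshold; the successor makes up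
   for truncation. *)
pose K := maxn N (Num.trunc (expR (expR (9 * M + ln (ln 2))))).+1.
have [p /= tp Kp] := infinite_nat_ge _ K tpc.
move: Kp; rewrite geq_max => /andP[Np Tp].
exists p.+2; first by rewrite !leqW.
have [_ smax] := @s_max_maximum R p.+2 isT.
have twin_quality : dgm_qualities R p.+2 (q_DGM R 2 p p.+2).
  by exists 2, p; split => //; exact: abc_triple_twin.
apply: le_trans (smax _ twin_quality).
apply: q_DGM_twin_unbounded => //.
by apply: (le_trans (ltW (truncnS_gt _))); rewrite ler_nat.
Unshelve. all: by end_near.
Qed.
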